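(* Let $k\ge 1$ be an integer and let $n$ be an odd positive integer with $\sigma(n)=2^k n$. Write $n={\Pi}\, q^{2\beta}\prod_{i=1}^{s}p_i^{2\beta_i}$, where ${\Pi}$ is the Euler part of $n$, $\beta,\beta_1,\dots,\beta_s$ are positive integers ($s\ge 0$), and $q,p_1,\dots,p_s$ are distinct odd primes (none dividing ${\Pi}$). Then $q^{2\beta}\mid \sigma({\Pi})$ if and only if, for every $i=1,\dots,s$: $$\begin{cases}2\beta_i+1\not\equiv 0 \pmod{\operatorname{ord}_q(p_i)}, & \text{if } p_i\not\equiv 1 \pmod q,\\ 2\beta_i+1\not\equiv 0 \pmod q, & \text{if } p_i\equiv 1 \pmod q,\end{cases}$$ where $\operatorname{ord}_q(m)$ is the multiplicative order of $m$ modulo $q$.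
   Context: $\sigma(m)$ denotes the sum of the positive divisors of $m$. For an odd positive integer $n$, its Euler part ${\Pi}$ is the product of all prime powers $p^e$ with $p^e\parallel n$ (i.e. $p^e\mid n$, $p^{e+1}\nmid n$) and $e$ odd; thus $n={\Pi}M^2$ with $\gcd({\Pi},M)=1$ and every prime dividing $M$ has even exponent in $n$. *)

(* Defs.v *)
From mathcomp Require Import all_boot all_order all_fingroup all_algebra all_solvable.

Set Implicit Arguments.
Unset Strict Implicit.
Unset Printing Implicit Defensive.

Import GRing.Theory.

Definition sigma (m : nat) : nat := \sum_(d <- divisors m) d.

Definition euler_part (n : nat) : nat :=
  \prod_(p <- primes n | odd (logn p n)) p ^ logn p n.

(* Order of the class of m in the group of units of Z/qZ, for 1 < q.  The
   value is 1 by default when m is not coprime to q. *)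
Definition ordmod (q m : nat) : nat :=
  #[insubd (1%g : {unit 'Z_q}) (m%:R)%R]%g.

Lemma dvdn_ordmod (q m t : nat) :
  1 < q -> coprime q m -> (ordmod q m %| t) = (m ^ t == 1 %[mod q]).
Proof.
move=> q_gt1 co_qm; rewrite /ordmod order_dvdn -2!val_eqE FinRing.val_unitX.
rewrite insubdK ?[_ \in _]unitZpE // -natrX /=.
by rewrite val_Zp_nat // -(val_Zp_nat q_gt1 1).
Qed.

(* Main.v *)
Require Import Defs.
From mathcomp Require Import all_boot all_order all_fingroup all_algebra all_solvable.

(** Since [sigma] is multiplicative, [sigma n] is the product of [sigma Pi],
    [sigma (q ^ 2beta)] and the [sigma (p_i ^ 2b_i)], and [q ^ 2beta] exactly
    divides it because it exactly divides [2 ^ k * n].  The factor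
    [sigma (q ^ 2beta)] is 1 modulo [q], so all of [q ^ 2beta] divides
    [sigma Pi] iff [q] divides no [sigma (p_i ^ 2b_i) = 1 + ... + p_i ^ 2b_i];
    this geometric sum is [2b_i + 1] modulo [q] when [p_i] is 1 modulo [q], and
    otherwise vanishes modulo [q] iff [p_i ^ (2b_i + 1)] is 1 modulo [q]. *)

(** Multiplication maps pairs of divisors of [m] and [n] bijectively onto the divisors of [m * n];
    the inverse is [d |-> (gcdn d m, gcdn d n)]. *)
Lemma sigmaM (m n : nat) :
  0 < m -> 0 < n -> coprime m n -> sigma (m * n) = sigma m * sigma n.
Proof.
move=> m_gt0 n_gt0 co_mn; have mn_gt0 : 0 < m * n by rewrite muln_gt0 m_gt0.
have gcdnM_coprime x y : x %| m -> y %| n ->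
    gcdn m (x * y) = x /\ gcdn n (x * y) = y.
  move=> xm yn; split.
    by rewrite Gauss_gcdl ?(coprime_dvdr yn) //; apply/gcdn_idPr.
  by rewrite Gauss_gcdr ?(coprime_dvdr xm) 1?coprime_sym //; apply/gcdn_idPr.
have uniq_prods : uniq [seq x * y | x <- divisors m, y <- divisors n].
  apply: allpairs_uniq; rewrite ?divisors_uniq //.
  move=> _ _ /allpairsP[[x y] /= [xm yn ->]] /allpairsP[[z t] /= [zm tn ->]] /=.
  rewrite -!dvdn_divisors // in xm yn zm tn => eq_xyzt.
  have [mx ny] := gcdnM_coprime _ _ xm yn.
  have [mz nt] := gcdnM_coprime _ _ zm tn.
  by congr (_, _); [rewrite -mx eq_xyzt mz | rewrite -ny eq_xyzt nt].
have perm_div : perm_eq (divisors (m * n))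
    [seq x * y | x <- divisors m, y <- divisors n].
  apply: uniq_perm; rewrite ?divisors_uniq // => d; rewrite -dvdn_divisors //.
  apply/idP/allpairsP => [d_mn | [[x y] /= [xm yn ->]]]; last first.
    by rewrite dvdn_mul // dvdn_divisors.
  exists (gcdn d m, gcdn d n); rewrite -!dvdn_divisors // !dvdn_gcdr.
  split=> //=; apply/eqP; rewrite eqn_dvd; apply/andP; split.
    (* Expanded, the product of the two gcds is a gcd of multiples of [d], the last one being
       [m * n]. *)
    by rewrite muln_gcdr dvdn_gcd dvdn_mull //= muln_gcdl dvdn_gcd dvdn_mulr.
  by rewrite Gauss_dvd ?dvdn_gcdl // (coprime_dvdl (dvdn_gcdr d m)) //
             (coprime_dvdr (dvdn_gcdr d n)).
by rewrite /sigma (perm_big _ perm_div) big_allpairs_dep /= big_distrlr.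
Qed.

Lemma sigma_prod (I : Type) (r : seq I) (F : I -> nat) :
    (forall i, 0 < F i) -> pairwise (fun i j => coprime (F i) (F j)) r ->
  sigma (\prod_(i <- r) F i) = \prod_(i <- r) sigma (F i).
Proof.
move=> F_gt0; elim: r => [|i r IHr] /=; first by rewrite !big_nil /sigma big_seq1.
case/andP=> co_ir co_r; rewrite !big_cons sigmaM ?IHr ?prodn_gt0 //.
(* This second induction makes [F i] coprime to the product over the tail. *)
elim: r co_ir {IHr co_r} => [|j r IHr] /=; first by rewrite big_nil coprimen1.
by case/andP=> co_ij /IHr co_ir; rewrite big_cons coprimeMr co_ij.
Qed.

Lemma sigma_pfactor (p e : nat) :
  prime p -> sigma (p ^ e) = \sum_(i < e.+1) p ^ i.
Proof.
move=> p_pr; rewrite -(big_mkord xpredT (fun i => p ^ i)) /index_iota subn0.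
rewrite -(big_map (fun i => p ^ i) xpredT id); apply: perm_big.
apply: uniq_perm; rewrite ?divisors_uniq ?map_inj_uniq ?iota_uniq //.
  exact/expnI/prime_gt1.
move=> d; rewrite -dvdn_divisors ?expn_gt0 ?prime_gt0 //.
apply/(dvdn_pfactor _ _ p_pr)/mapP=> -[i le_ie ->]; exists i => //;
  by move: le_ie; rewrite mem_iota.
Qed.

Lemma dvdn_sum_expn (q p e : nat) : prime q -> ~~ (q %| p) ->
  (q %| \sum_(i < e) p ^ i) =
    if p == 1 %[mod q] then q %| e else ordmod q p %| e.
Proof.
move=> q_pr q_p; have p_gt0: 0 < p by case: p q_p => //; rewrite dvdn0.
case: ifPn => [/eqP p1 | p1].
  rewrite /dvdn -modn_summ (eq_bigr (fun=> 1 %% q)).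
    by rewrite sum_nat_const card_ord modnMmr muln1.
  by move=> i _; rewrite -modnXm p1 modnXm exp1n.
rewrite dvdn_ordmod ?prime_gt1 ?prime_coprime //.
rewrite eqn_mod_dvd ?expn_gt0 ?p_gt0 // subn1 predn_exp Euclid_dvdM //.
by rewrite -subn1 -eqn_mod_dvd // (negPf p1).
Qed.

Theorem theorem3p1 (k n : nat) (q beta s : nat) (p b : 'I_s -> nat)
    (hk : 1 <= k) (hn : odd n) (hsigma : sigma n = 2 ^ k * n)
    (hq : prime q) (hqodd : odd q) (hbeta : 0 < beta)
    (hp : forall i, prime (p i)) (hpodd : forall i, odd (p i))
    (hb : forall i, 0 < b i)
    (hpinj : injective p) (hpq : forall i, p i <> q)
    (hqPi : ~~ (q %| euler_part n)) (hpPi : forall i, ~~ (p i %| euler_part n))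
    (hfact : n = euler_part n * q ^ (2 * beta) * \prod_(i < s) p i ^ (2 * b i)) :
  q ^ (2 * beta) %| sigma (euler_part n) <->
  forall i : 'I_s,
    (p i <> 1 %[mod q] -> 2 * b i + 1 <> 0 %[mod ordmod q (p i)]) /\
    (p i = 1 %[mod q] -> 2 * b i + 1 <> 0 %[mod q]).
Proof.
have q_p i : ~~ (q %| p i) by rewrite dvdn_prime2 // eq_sym; apply/eqP.
pose S i := sigma (p i ^ (2 * b i)).
(* The sum [sigma (p i ^ (2 * b i))] has [2 * b i + 1] terms. In each case on [p i] modulo [q], one
   of the two implications is vacuous. *)
have condP i : ((p i <> 1 %[mod q] -> 2 * b i + 1 <> 0 %[mod ordmod q (p i)]) /\
    (p i = 1 %[mod q] -> 2 * b i + 1 <> 0 %[mod q])) <-> ~~ (q %| S i).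
  rewrite /S sigma_pfactor // dvdn_sum_expn // addn1 !mod0n /dvdn.
  case: eqP => p1; split.
  - by case=> _ /(_ p1) /eqP.
  - by move/eqP.
  - by case=> /(_ p1) /eqP.
  - by move/eqP.
have Pi_gt0 : 0 < euler_part n by case: (euler_part n) hqPi => //; rewrite dvdn0.
have pb_gt0 i : 0 < p i ^ (2 * b i) by rewrite expn_gt0 prime_gt0.
have qb_gt0 : 0 < q ^ (2 * beta) by rewrite expn_gt0 prime_gt0.
have co_Pi_q : coprime (euler_part n) (q ^ (2 * beta)).
  by rewrite coprimeXr // coprime_sym prime_coprime.
have co_prod (m : nat) : (forall i, ~~ (p i %| m)) ->
    coprime m (\prod_(i < s) p i ^ (2 * b i)).
  move=> p_m; apply: (big_ind (coprime m)) => [|x y mx my|i _]; first exact: coprimen1.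
    by rewrite coprimeMr mx.
  by rewrite coprimeXr // coprime_sym prime_coprime.
have p_q i : ~~ (p i %| q) by rewrite dvdn_prime2 //; apply/eqP.
have sigma_n : sigma n =
    sigma (euler_part n) * sigma (q ^ (2 * beta)) * \prod_(i < s) S i.
  rewrite {1}hfact !sigmaM ?muln_gt0 ?Pi_gt0 ?prodn_gt0 //; last first.
    by rewrite coprimeMl co_prod // coprimeXl ?co_prod.
  (* Pairwise coprimality follows from the injectivity of [p], since the enumeration of ['I_s] has
     no repetition. *)
  rewrite sigma_prod //; have := index_enum_uniq 'I_s; rewrite uniq_pairwise.
  apply: sub_pairwise => i j /= ij; rewrite coprimeXl ?coprimeXr //.
  by rewrite prime_coprime // dvdn_prime2 // (inj_eq hpinj).
have co_q_sq : coprime q (sigma (q ^ (2 * beta))).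
  rewrite sigma_pfactor // big_ord_recl expn0 prime_coprime //.
  rewrite dvdn_addl ?dvdn1 ?gtn_eqF ?prime_gt1 //.
  by apply: dvdn_sum => i _; rewrite expnS dvdn_mulr.
(* The power of [q] is isolated; its cofactor is coprime to [q], with [q] odd taking care of
   [2 ^ k]. *)
have sigma_nE : sigma n = 2 ^ k * euler_part n *
    (\prod_(i < s) p i ^ (2 * b i)) * q ^ (2 * beta).
  by rewrite hsigma {1}hfact !mulnA; rewrite -!mulnA; congr (_ * (_ * _)); rewrite mulnC.
have co_q_rest : coprime q
    (2 ^ k * euler_part n * \prod_(i < s) p i ^ (2 * b i)).
  rewrite !coprimeMr co_prod // andbT coprimeXr ?prime_coprime ?hqPi //.
  by rewrite -prime_coprime // coprimen2.
split=> [q_Pi i | S_q].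
  (* Otherwise [q ^ (2 * beta + 1)] would divide [sigma n], one power too many. *)
  apply/condP/negP => q_S.
  have : q ^ (2 * beta) * q %| sigma n.
    rewrite sigma_n dvdn_mul ?dvdn_mulr // (bigD1 i) //= dvdn_mulr //.
  rewrite sigma_nE mulnC dvdn_pmul2r //.
  by apply/negP; rewrite -prime_coprime.
have : q ^ (2 * beta) %| sigma n by rewrite sigma_nE dvdn_mull.
(* Gauss's lemma removes the factors of [sigma n] coprime to [q], leaving [sigma (euler_part n)]. *)
rewrite sigma_n !Gauss_dvdl ?coprimeXl //.
apply: (big_ind (coprime q)) => [|x y qx qy|i _]; first exact: coprimen1.
  by rewrite coprimeMr qx.
by rewrite prime_coprime //; apply/condP.
Qed.
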